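(* Let $X$ be a countably infinite set, let $k\ge1$ be an integer, and let $E_k\subseteq X^2$ be an equivalence relation on $X$ all of whose equivalence classes have exactly $k$ elements. Then the group $\operatorname{Aut}(X,E_k)$ does not have any non-singular mixed identities (in any finite number $r$ of variables).
   Context: $\operatorname{Aut}(X,E_k)$ is the group of bijections $g$ of $X$ such that $(x,y)\in E_k$ iff $(x.g,y.g)\in E_k$. For a group $G$ and the free group $\mathbf F_r=\langle x_1,\dots,x_r\rangle$, a word with constants in $G$ is an element $w\in G\ast\mathbf F_r$. For $g_1,\dots,g_r\in G$, $w(g_1,\dots,g_r)\in G$ denotes the image of $w$ under the homomorphism $G\ast\mathbf F_r\to G$ that is the identity on $G$ and sends $x_i\mapsto g_i$. The word $w$ is a mixed identity for $G$ if $w\neq1$ in $G\ast\mathbf F_r$ and $w(g_1,\dots,g_r)=1_G$ for all $g_1,\dots,g_r\in G$. Let $\epsilon\colon G\ast\mathbf F_r\to\mathbf F_r$ be the homomorphism that sends every element of $G$ to $1$ and is the identity on $\mathbf F_r$; $w$ is singular if $\epsilon(w)=1$ and non-singular otherwise. *)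

(* Defs.v *)
From HB Require Import structures.
From mathcomp Require Import all_boot.
From mathcomp Require Import generic_quotient.
From mathcomp Require Import boolp classical_sets functions cardinality.

Set Implicit Arguments.
Unset Strict Implicit.
Unset Printing Implicit Defensive.

Local Open Scope quotient_scope.
Local Open Scope group_scope.

(* The groupTypes of MathComp's monoid.v are not assumed finite; F_r and G * H
   are both quotients of a monoid of words by a congruence. *)

Inductive cong (A : Type) (R : seq A -> seq A -> Prop) :
    seq A -> seq A -> Prop :=
| cong_step s t u v : R u v -> cong R (s ++ u ++ t) (s ++ v ++ t)
| cong_refl u : cong R u u
| cong_sym u v : cong R u v -> cong R v u
| cong_trans u v w : cong R u v -> cong R v w -> cong R u w.

(* [linv] assigns to each letter a formal inverse; the last two fields ensure
   that the presented monoid is a group. *)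
Record presentation := Presentation {
  letter : choiceType;
  linv : letter -> letter;
  relator : seq letter -> seq letter -> Prop;
  linvl : forall a, cong relator [:: linv a; a] [::];
  linvr : forall a, cong relator [:: a; linv a] [::]
}.

Section PresentedGroup.
Variable P : presentation.
Local Notation word := (seq (letter P)).
Local Notation R := (@relator P).

Lemma cong_cat (u u' v v' : word) :
  cong R u u' -> cong R v v' -> cong R (u ++ v) (u' ++ v').
Proof.
move=> uu' vv'; apply: (@cong_trans _ _ _ (u' ++ v)).
  elim: uu' => [s t a b ab|a|a b _|a b c _ ab _ bc].
  - by rewrite -!catA; apply: cong_step.
  - exact: cong_refl.
  - exact: cong_sym.
  - exact: cong_trans bc.
elim: vv' => [s t a b ab|a|a b _|a b c _ ab _ bc].
- by rewrite !(catA u'); apply: cong_step.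
- exact: cong_refl.
- exact: cong_sym.
- exact: cong_trans bc.
Qed.

Definition winv (u : word) : word := rev (map (@linv P) u).

Lemma winvl u : cong R (winv u ++ u) [::].
Proof.
elim: u => [|a u IHu]; first exact: cong_refl.
rewrite /winv /= rev_cons -cats1 -catA /=.
apply: cong_trans IHu; apply: cong_cat; first exact: cong_refl.
exact: (cong_cat (linvl a) (cong_refl _ u)).
Qed.

Lemma winvr u : cong R (u ++ winv u) [::].
Proof.
elim: u => [|a u IHu]; first exact: cong_refl.
rewrite /winv /= rev_cons -cats1 -cat1s -/(winv u) -?catA.
apply: cong_trans (linvr a); rewrite -[X in cong _ _ X]cat1s.
apply: cong_cat; first exact: cong_refl.
by rewrite catA; apply: (cong_cat IHu); apply: cong_refl.
Qed.

Definition congb (u v : word) : bool := `[< cong R u v >].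

Lemma congb_refl : reflexive congb.
Proof. by move=> u; apply/asboolP; apply: cong_refl. Qed.
Lemma congb_sym : symmetric congb.
Proof. by move=> u v; apply/asboolP/asboolP; apply: cong_sym. Qed.
Lemma congb_trans : transitive congb.
Proof.
by move=> v u w /asboolP uv /asboolP vw; apply/asboolP; apply: cong_trans vw.
Qed.

Canonical cong_equiv := EquivRel congb congb_refl congb_sym congb_trans.

Definition pgroup := {eq_quot cong_equiv}.
HB.instance Definition _ := Choice.on pgroup.
HB.instance Definition _ := Quotient.on pgroup.

Definition wclass (u : word) : pgroup := \pi_pgroup u.

Lemma wclassP u v : wclass u = wclass v <-> cong R u v.
Proof.
rewrite /wclass; split=> [/(@eqquotP _ cong_equiv) /asboolP //|uv].
by apply/(@eqquotP _ cong_equiv)/asboolP.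
Qed.

Lemma wclassK (x : pgroup) : wclass (repr x) = x.
Proof. exact: reprK. Qed.

Definition pone : pgroup := wclass [::].
Definition pmul (x y : pgroup) : pgroup := wclass (repr x ++ repr y).
Definition pinv (x : pgroup) : pgroup := wclass (winv (repr x)).

Lemma cong_repr u : cong R (repr (wclass u)) u.
Proof. by apply/wclassP; rewrite wclassK. Qed.

Lemma pmulE u v : pmul (wclass u) (wclass v) = wclass (u ++ v).
Proof. by apply/wclassP; apply: cong_cat; apply: cong_repr. Qed.

Lemma pmulA : associative pmul.
Proof.
by move=> x y z; rewrite -[x]wclassK -[y]wclassK -[z]wclassK !pmulE catA.
Qed.
Lemma pmul1g : left_id pone pmul.
Proof. by move=> x; rewrite -[x]wclassK pmulE. Qed.
Lemma pmulg1 : right_id pone pmul.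
Proof. by move=> x; rewrite -[x]wclassK pmulE cats0. Qed.
Lemma pmulVg : left_inverse pone pinv pmul.
Proof.
by move=> x; rewrite -{2}[x]wclassK pmulE; apply/wclassP; apply: winvl.
Qed.
Lemma pmulgV : right_inverse pone pinv pmul.
Proof.
by move=> x; rewrite -{1}[x]wclassK pmulE; apply/wclassP; apply: winvr.
Qed.

HB.instance Definition _ :=
  isGroup.Build pgroup pmulA pmul1g pmulg1 pmulVg pmulgV.

Lemma wclassM u v : wclass (u ++ v) = wclass u * wclass v.
Proof. by rewrite -pmulE. Qed.

Lemma wclass_prod u : wclass u = \prod_(a <- u) wclass [:: a].
Proof.
elim: u => [|a u IHu]; first by rewrite big_nil.
by rewrite big_cons -IHu -wclassM.
Qed.

Section Lift.
Variables (K : groupType) (f : letter P -> K).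

(* Independent of the chosen representative only under [lift_ok]. *)
Definition plift (x : pgroup) : K := \prod_(a <- repr x) f a.

Definition lift_ok := forall u v,
  R u v -> \prod_(a <- u) f a = \prod_(a <- v) f a.

Hypothesis fR : lift_ok.

Lemma pliftE u : plift (wclass u) = \prod_(a <- u) f a.
Proof.
have fcong v w : cong R v w -> \prod_(a <- v) f a = \prod_(a <- w) f a.
  elim=> [s t a b ab|//|//|a b c _ -> _ -> //].
  by rewrite !big_cat /= (fR ab).
exact/fcong/cong_repr.
Qed.

Lemma plift_morphism : monoid_morphism plift.
Proof.
split=> [|x y]; first by rewrite pliftE big_nil.
by rewrite -[x]wclassK -[y]wclassK -wclassM !pliftE big_cat.
Qed.
End Lift.

End PresentedGroup.

Section FreeGroup.
Variable r : nat.

(* The letter (i, false) is the generator x_i and (i, true) is its inverse. *)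
Let gen_letter := ('I_r * bool)%type.

Variant free_rel : seq gen_letter -> seq gen_letter -> Prop :=
| FreeCancel i b : free_rel [:: (i, b); (i, ~~ b)] [::].

Let free_linv (a : gen_letter) : gen_letter := (a.1, ~~ a.2).

Lemma free_linvr a : cong free_rel [:: a; free_linv a] [::].
Proof. by case: a => i b; apply: (cong_step [::] [::] (FreeCancel i b)). Qed.

Lemma free_linvl a : cong free_rel [:: free_linv a; a] [::].
Proof.
have := free_linvr (free_linv a).
by case: a => i b; rewrite /free_linv /= negbK.
Qed.

Definition free_pres := Presentation free_linvl free_linvr.

Definition freegroup := pgroup free_pres.
HB.instance Definition _ := Group.on freegroup.

Definition fgen (i : 'I_r) : freegroup := @wclass free_pres [:: (i, false)].

Section Lift.
Variables (K : groupType) (g : 'I_r -> K).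

Definition free_lift : freegroup -> K :=
  @plift free_pres K (fun a => if a.2 then (g a.1)^-1 else g a.1).

Lemma free_lift_ok :
  @lift_ok free_pres K (fun a => if a.2 then (g a.1)^-1 else g a.1).
Proof.
by move=> _ _ [i []]; rewrite !big_cons !big_nil /= mulg1 ?mulVg ?mulgV.
Qed.

HB.instance Definition _ := isUMagmaMorphism.Build freegroup K free_lift
  (plift_morphism free_lift_ok).

Lemma free_lift_gen i : free_lift (fgen i) = g i.
Proof. by rewrite /free_lift (pliftE free_lift_ok) big_seq1. Qed.

Lemma free_lift_uniq (phi : UMagmaMorphism.type freegroup K) :
  (forall i, phi (fgen i) = g i) -> phi =1 free_lift.
Proof.
move=> phig x; rewrite -[x]wclassK /free_lift (pliftE free_lift_ok).
rewrite wclass_prod gmulf_prod; apply: eq_bigr => -[i []] _ //=; last exact: phig.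
rewrite -phig -gmulfV; congr (phi _); apply: (mulIg (fgen i)).
rewrite mulVg -wclassM; apply/wclassP.
exact: (cong_step [::] [::] (FreeCancel i true)).
Qed.
End Lift.

End FreeGroup.

Section FreeProduct.
Variables G H : groupType.

Let fp_letter := (G + H)%type.

Variant fp_rel : seq fp_letter -> seq fp_letter -> Prop :=
| FpOneL : fp_rel [:: inl 1] [::]
| FpOneR : fp_rel [:: inr 1] [::]
| FpMulL a b : fp_rel [:: inl a; inl b] [:: inl (a * b)]
| FpMulR a b : fp_rel [:: inr a; inr b] [:: inr (a * b)].

Let fp_linv (a : fp_letter) : fp_letter :=
  match a with inl x => inl x^-1 | inr y => inr y^-1 end.

Lemma fp_linvl a : cong fp_rel [:: fp_linv a; a] [::].
Proof.
case: a => x /=.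
- apply: (cong_trans (cong_step [::] [::] (FpMulL _ _))).
  by rewrite mulVg; apply: (cong_step [::] [::] FpOneL).
- apply: (cong_trans (cong_step [::] [::] (FpMulR _ _))).
  by rewrite mulVg; apply: (cong_step [::] [::] FpOneR).
Qed.

Lemma fp_linvr a : cong fp_rel [:: a; fp_linv a] [::].
Proof.
by have := fp_linvl (fp_linv a); case: a => x /=; rewrite invgK.
Qed.

Definition fp_pres := Presentation fp_linvl fp_linvr.

Definition freeprod := pgroup fp_pres.
HB.instance Definition _ := Group.on freeprod.

Definition fp_inl (a : G) : freeprod := @wclass fp_pres [:: inl a].
Definition fp_inr (b : H) : freeprod := @wclass fp_pres [:: inr b].

Lemma fp_inl_morphism : monoid_morphism fp_inl.
Proof.
split=> [|a b].
  by apply/wclassP; apply: (cong_step [::] [::] FpOneL).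
rewrite -wclassM; apply/wclassP/cong_sym.
exact: (cong_step [::] [::] (FpMulL a b)).
Qed.

Lemma fp_inr_morphism : monoid_morphism fp_inr.
Proof.
split=> [|a b].
  by apply/wclassP; apply: (cong_step [::] [::] FpOneR).
rewrite -wclassM; apply/wclassP/cong_sym.
exact: (cong_step [::] [::] (FpMulR a b)).
Qed.

HB.instance Definition _ :=
  isUMagmaMorphism.Build G freeprod fp_inl fp_inl_morphism.
HB.instance Definition _ :=
  isUMagmaMorphism.Build H freeprod fp_inr fp_inr_morphism.

Section Lift.
Variables (K : groupType).
Variables (f : UMagmaMorphism.type G K).
Variables (g : UMagmaMorphism.type H K).

Definition fp_lift : freeprod -> K :=
  @plift fp_pres K (fun a => match a with inl x => f x | inr y => g y end).

Lemma fp_lift_ok :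
  @lift_ok fp_pres K (fun a => match a with inl x => f x | inr y => g y end).
Proof.
by move=> _ _ [||a b|a b]; rewrite !big_cons !big_nil ?mulg1 ?gmulf1 ?gmulfM.
Qed.

HB.instance Definition _ := isUMagmaMorphism.Build freeprod K fp_lift
  (plift_morphism fp_lift_ok).

Lemma fp_lift_inl a : fp_lift (fp_inl a) = f a.
Proof. by rewrite /fp_lift (pliftE fp_lift_ok) big_seq1. Qed.

Lemma fp_lift_inr b : fp_lift (fp_inr b) = g b.
Proof. by rewrite /fp_lift (pliftE fp_lift_ok) big_seq1. Qed.

Lemma fp_lift_uniq (phi : UMagmaMorphism.type freeprod K) :
  (forall a, phi (fp_inl a) = f a) -> (forall b, phi (fp_inr b) = g b) ->
  phi =1 fp_lift.
Proof.
move=> phif phig x; rewrite -[x]wclassK /fp_lift (pliftE fp_lift_ok).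
rewrite wclass_prod gmulf_prod; apply: eq_bigr => -[a|b] _ /=.
- exact: phif.
- exact: phig.
Qed.
End Lift.

End FreeProduct.

Section MixedIdentities.
Variables (G : groupType) (r : nat).

Definition cword := freeprod G (freegroup r).
HB.instance Definition _ := Group.on cword.

Definition cconst (a : G) : cword := fp_inl (freegroup r) a.
Definition cvar (i : 'I_r) : cword := fp_inr G (fgen i).

Definition weval (g : 'I_r -> G) : cword -> G :=
  fp_lift (idfun : G -> G) (free_lift g).
HB.instance Definition _ (g : 'I_r -> G) := UMagmaMorphism.on (weval g).

Lemma weval_const g a : weval g (cconst a) = a.
Proof. exact: fp_lift_inl. Qed.
Lemma weval_var g i : weval g (cvar i) = g i.
Proof. by rewrite /weval fp_lift_inr /= free_lift_gen. Qed.

Definition augmentation : cword -> freegroup r :=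
  fp_lift (@one_fun G (freegroup r)) (idfun : freegroup r -> freegroup r).
HB.instance Definition _ := UMagmaMorphism.on augmentation.

Lemma augmentation_const a : augmentation (cconst a) = 1.
Proof. exact: fp_lift_inl. Qed.
Lemma augmentation_var i : augmentation (cvar i) = fgen i.
Proof. exact: fp_lift_inr. Qed.

Definition mixed_identity (w : cword) : Prop :=
  w <> 1 /\ forall g : 'I_r -> G, weval g w = 1.

Definition singular (w : cword) : Prop := augmentation w = 1.

End MixedIdentities.

Section Aut.
Variables (X : Type) (E : X -> X -> Prop).

Record aut := Aut {
  aut_fun :> X -> X;
  aut_bij : bijective aut_fun;
  aut_rel : forall x y, E x y <-> E (aut_fun x) (aut_fun y)
}.

HB.instance Definition _ := gen_eqMixin aut.
HB.instance Definition _ := gen_choiceMixin aut.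

Lemma autP (g h : aut) : (forall x, g x = h x) -> g = h.
Proof.
case: g h => [g gb gE] [h hb hE] /= /funext gh; subst h.
by congr Aut; apply: Prop_irrelevance.
Qed.

Lemma aut_invP (g : aut) :
  exists h : aut, (forall x, h (g x) = x) /\ (forall x, g (h x) = x).
Proof.
have [h gK hK] := aut_bij g.
have hE x y : E x y <-> E (h x) (h y).
  by rewrite (aut_rel g (h x)) !hK.
by exists (Aut (Bijective hK gK) hE); split.
Qed.

Definition aut_inv (g : aut) : aut := projT1 (cid (aut_invP g)).

Lemma aut_one_bij : bijective (@id X).
Proof. by exists id. Qed.
Lemma aut_one_rel x y : E x y <-> E (id x) (id y).
Proof. by []. Qed.
Definition aut_one := Aut aut_one_bij aut_one_rel.

(* Automorphisms act on the right: x.(gh) = (x.g).h *)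
Lemma aut_mul_bij (g h : aut) : bijective (h \o g).
Proof. exact: bij_comp (aut_bij h) (aut_bij g). Qed.
Lemma aut_mul_rel (g h : aut) x y : E x y <-> E ((h \o g) x) ((h \o g) y).
Proof. by rewrite (aut_rel g) (aut_rel h). Qed.
Definition aut_mul (g h : aut) := Aut (aut_mul_bij g h) (aut_mul_rel g h).

Lemma aut_mulA : associative aut_mul.
Proof. by move=> f g h; apply: autP. Qed.
Lemma aut_mul1g : left_id aut_one aut_mul.
Proof. by move=> g; apply: autP. Qed.
Lemma aut_mulg1 : right_id aut_one aut_mul.
Proof. by move=> g; apply: autP. Qed.
Lemma aut_mulVg : left_inverse aut_one aut_inv aut_mul.
Proof.
by move=> g; apply: autP => x; rewrite /aut_inv; case: cid => h [hg gh] /=.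
Qed.
Lemma aut_mulgV : right_inverse aut_one aut_inv aut_mul.
Proof.
by move=> g; apply: autP => x; rewrite /aut_inv; case: cid => h [hg gh] /=.
Qed.

HB.instance Definition _ :=
  isGroup.Build aut aut_mulA aut_mul1g aut_mulg1 aut_mulVg aut_mulgV.

End Aut.

(* Main.v *)
Require Import Defs.
From mathcomp Require Import all_boot.
From mathcomp Require Import boolp classical_sets functions cardinality.
From Stdlib Require Import RelationClasses.

Set Implicit Arguments.
Unset Strict Implicit.
Unset Printing Implicit Defensive.

Local Open Scope group_scope.

(* Call c small if it preserves all but finitely many E-classes. If c is small,
   then x c x^-1 moves a number of classes bounded independently of x, so
   cancelling all such subwords turns w into a word w' with the same
   augmentation, and the identity w = 1 bounds the number of classes on which w'
   differs from a fixed automorphism d. As w is non-singular, w' still contains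
   a variable, and the constants of w' between x and x^-1 move infinitely many
   classes. Hence one can trace any finite number of disjoint trajectories of w'
   through fresh classes, each ending away from the image of its start under d;
   composing swaps of two classes gives values of the variables that follow
   these trajectories, a contradiction. *)

(** * Words with constants as sequences of syllables *)

Section LetterWords.
Variables (r : nat) (K : groupType).

Definition letter_val (g : 'I_r -> K) (a : 'I_r * bool) : K :=
  if a.2 then (g a.1)^-1 else g a.1.

Lemma letter_valV g a : letter_val g (a.1, ~~ a.2) = (letter_val g a)^-1.
Proof. by case: a => i [] /=; rewrite /letter_val //= invgK. Qed.

(** The triple [(i, b, c)] stands for the syllable x_i c, or x_i^-1 c if [b] holds. *)
Definition word_val (g : 'I_r -> K) (s : seq ('I_r * bool * K)) : K :=
  \prod_(t <- s) (letter_val g t.1 * t.2).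

Lemma word_val_cons g t s :
  word_val g (t :: s) = letter_val g t.1 * t.2 * word_val g s.
Proof. by rewrite /word_val big_cons. Qed.

End LetterWords.

Section NormalForm.
Variables (G : groupType) (r : nat).
Implicit Type s : seq ('I_r * bool * G).

Definition forget s : freegroup r :=
  \prod_(t <- s) letter_val (@fgen r) t.1.

Definition cword_of (c : G) s : cword G r :=
  cconst r c * \prod_(t <- s) (letter_val (@cvar G r) t.1 * cconst r t.2).

Lemma wclass_letter (a : 'I_r * bool) :
  @wclass (free_pres r) [:: a] = letter_val (@fgen r) a.
Proof.
case: a => i []; rewrite /letter_val //=.
apply: (mulIg (fgen i)); rewrite mulVg -wclassM; apply/wclassP.
exact: (cong_step [::] [::] (FreeCancel i true)).
Qed.

Lemma fp_inr_letter (a : 'I_r * bool) :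
  fp_inr G (letter_val (@fgen r) a) = letter_val (@cvar G r) a.
Proof. by case: a => i []; rewrite /letter_val //= gmulfV. Qed.

(** Induction on a representative: a constant is absorbed into [c], and each letter of a free-group
    factor opens a syllable that takes the former leading constant as its own. *)
Lemma cword_ofP (w : cword G r) : exists c s, w = cword_of c s.
Proof.
rewrite -[w]wclassK; elim: (repr w) => [|a u [c [s IH]]].
  by exists 1, [::]; rewrite /cword_of big_nil mulg1 /cconst gmulf1.
rewrite -cat1s wclassM IH; case: a => [b|f].
  by exists (b * c), s; rewrite /cword_of mulgA /cconst gmulfM.
rewrite -[f]wclassK -/(fp_inr G _); elim: (repr f) => [|a v [c' [s' IHv]]].
  by exists c, s; rewrite [X in X * _](_ : _ = 1) ?mul1g // gmulf1.
exists 1, ((a, c') :: s').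
rewrite -cat1s wclassM gmulfM -mulgA IHv wclass_letter.
rewrite [X in X * _]fp_inr_letter.
by rewrite /cword_of big_cons /cconst gmulf1 mul1g mulgA.
Qed.

Lemma weval_cword_of g c s : weval g (cword_of c s) = c * word_val g s.
Proof.
rewrite gmulfM [X in X * _]weval_const gmulf_prod; congr (_ * _).
apply: eq_bigr => -[[i b] d] _; rewrite gmulfM [X in _ * X]weval_const /=.
congr (_ * _).
case: b; rewrite /letter_val /= ?gmulfV; last exact: weval_var.
by congr (_^-1); apply: weval_var.
Qed.

Lemma augmentation_cword_of c s : augmentation (cword_of c s) = forget s.
Proof.
rewrite gmulfM [X in X * _]augmentation_const mul1g gmulf_prod.
apply: eq_bigr => -[[i b] d] _; rewrite gmulfM /=.
rewrite [X in _ * X]augmentation_const mulg1.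
case: b; rewrite /letter_val /= ?gmulfV; last exact: augmentation_var.
by congr (_^-1); apply: augmentation_var.
Qed.

End NormalForm.

(** * Classes, swaps and fresh points *)

Section Classes.
Variables (X : Type) (E : X -> X -> Prop) (k : nat).
Hypothesis E_equiv : Equivalence E.
Hypothesis X_countable : ([set: X] #= [set: nat])%card.
Hypothesis E_class :
  forall x : X, ([set y | E x y]%classic #= `I_k)%card.

Let Erefl x : E x x. Proof. exact: reflexivity. Qed.
Let Esym x y : E x y -> E y x. Proof. exact: symmetry. Qed.
Let Etrans y x z : E x y -> E y z -> E x z. Proof. exact: transitivity. Qed.

Lemma aut_mulE (g h : aut E) x : (g * h) x = h (g x). Proof. by []. Qed.
Lemma autK (g : aut E) x : g^-1 (g x) = x.
Proof. by rewrite -aut_mulE mulgV. Qed.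
Lemma autVK (g : aut E) x : g (g^-1 x) = x.
Proof. by rewrite -aut_mulE mulVg. Qed.

(** Both classes are indexed by [I_k]; points of equal index correspond. Off the classes the values
    are arbitrary. *)
Lemma class_transfer p q : exists f : X -> X, exists f' : X -> X,
  (forall x, E p x -> E q (f x) /\ f' (f x) = x) /\
  (forall x, E q x -> E p (f' x) /\ f (f' x) = x).
Proof.
have /card_set_bijP[u [uM uI uS]] := E_class p.
have /card_set_bijP[v [vM vI vS]] := E_class q.
have /choice[f fP] : forall x, exists y, E p x -> E q y /\ v y = u x.
  move=> x; have [px|npx] := pselect (E p x); last by exists x.
  by have [y qy yx] := vS _ (uM _ px); exists y.
have /choice[f' f'P] : forall x, exists y, E q x -> E p y /\ u y = v x.
  move=> x; have [px|npx] := pselect (E q x); last by exists x.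
  by have [y qy yx] := uS _ (vM _ px); exists y.
exists f, f'; split=> x xP.
- have [fq fv] := fP _ xP; split=> //.
  have [f'p f'u] := f'P _ fq.
  by apply: uI; rewrite ?inE //= f'u.
- have [fq fv] := f'P _ xP; split=> //.
  have [f'p f'u] := fP _ fq.
  by apply: vI; rewrite ?inE //= f'u.
Qed.

Lemma class_swap p q : ~ E p q ->
  exists h : aut E, E (h p) q /\ forall x, ~ E p x -> ~ E q x -> h x = x.
Proof.
move=> npq; have [f [f' [fP f'P]]] := class_transfer p q.
pose h x := if `[< E p x >] then f x else if `[< E q x >] then f' x else x.
have hp x : E p x -> h x = f x by move=> px; rewrite /h asboolT.
have npq' x : E q x -> ~ E p x.
  by move=> qx px; apply: npq; apply: Etrans px (Esym qx).
have hq x : E q x -> h x = f' x.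
  by move=> qx; rewrite /h asboolF ?asboolT //; apply: npq'.
have hn x : ~ E p x -> ~ E q x -> h x = x by move=> px qx; rewrite /h !asboolF.
have hK : involutive h.
  move=> x; have [px|px] := pselect (E p x).
    by have [qf fK] := fP x px; rewrite (hp _ px) (hq _ qf).
  have [qx|qx] := pselect (E q x); last by rewrite !hn.
  by have [pf fK] := f'P x qx; rewrite (hq _ qx) (hp _ pf).
have hE x y : E x y -> E (h x) (h y).
  move=> xy; have [px|px] := pselect (E p x).
    have py := Etrans px xy; rewrite !hp //.
    exact: Etrans (Esym (proj1 (fP _ px))) (proj1 (fP _ py)).
  have [qx|qx] := pselect (E q x).
    have qy := Etrans qx xy; rewrite !hq //.
    exact: Etrans (Esym (proj1 (f'P _ qx))) (proj1 (f'P _ qy)).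
  rewrite !hn // => [py|qy]; [apply: px|apply: qx]; exact: Etrans (Esym xy).
have hE' x y : E x y <-> E (h x) (h y).
  by split=> [|/hE]; [apply: hE|rewrite !hK].
exists (Aut (inv_bij hK) hE'); split=> //=.
by rewrite hp //; apply: Esym; apply: (proj1 (fP _ _)).
Qed.

Definition meets v (L : seq X) : bool := has (fun y => `[< E y v >]) L.

Lemma meets_map (h : aut E) v L : meets (h v) (map h L) = meets v L.
Proof.
rewrite /meets has_map; apply: eq_has => y /=.
by apply/asboolP/asboolP; rewrite -aut_rel.
Qed.

Lemma meets_mapV (h : aut E) v L : meets v (map (h^-1)%g L) = meets (h v) L.
Proof. by rewrite -[v in LHS](autK h) meets_map. Qed.

Lemma meetsPn v L y : ~~ meets v (y :: L) <-> ~ E y v /\ ~~ meets v L.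
Proof.
rewrite /meets /= negb_or; split=> [/andP[/asboolPn]//|[yv ->]].
by rewrite andbT; apply/asboolPn.
Qed.

(** Finitely many finite classes do not cover the infinite [X]. *)
Lemma fresh_point L : exists v, ~~ meets v L.
Proof.
apply: contrapT => nofresh; apply: infinite_nat.
rewrite -(eq_finite_set X_countable).
suff Lfin : finite_set [set v | meets v L]%classic.
  apply: sub_finite_set Lfin => v _ /=; apply: contrapT => /negP mv.
  by apply: nofresh; exists v.
elim: L {nofresh} => [|y L IH].
  by apply: sub_finite_set (finite_set0 X) => v.
have -> : [set v | meets v (y :: L)]%classic =
    ([set v | E y v] `|` [set v | meets v L])%classic.
  apply/seteqP; split=> v /=.
    by move=> /orP[/asboolP|]; [left|right].
  by move=> [yv|mv]; apply/orP; [left; apply/asboolP|right].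
by rewrite finite_setU; split=> //; apply/finite_setP; exists k; apply: E_class.
Qed.

(** * Agreement on all but boundedly many classes *)

Definition near M (a b : aut E) : Prop :=
  exists2 L : seq X, (size L <= M)%N & forall v, ~~ meets v L -> E (a v) (b v).

Lemma near_refl a : near 0 a a.
Proof. by exists [::] => // v _; apply: Erefl. Qed.

Lemma near_sym M a b : near M a b -> near M b a.
Proof. by move=> [L LM ab]; exists L => // v /ab/Esym. Qed.

Lemma near_trans M N a b c : near M a b -> near N b c -> near (M + N) a c.
Proof.
move=> [L LM ab] [L' LN bc]; exists (L ++ L').
  by rewrite size_cat leq_add.
move=> v; rewrite /meets has_cat negb_or => /andP[/ab abv /bc].
exact: Etrans abv.
Qed.

(** The action is on the right, so [h] acts first; pulling [L] back along [h] keeps its size, which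
    makes the bounds uniform in the substitution. *)
Lemma near_mull M h a b : near M a b -> near M (h * a) (h * b).
Proof.
move=> [L LM ab]; exists (map (h^-1)%g L); first by rewrite size_map.
by move=> v; rewrite meets_mapV => /ab.
Qed.

Lemma near_mulr M h a b : near M a b -> near M (a * h) (b * h).
Proof.
by move=> [L LM ab]; exists L => // v /ab abv; rewrite !aut_mulE -aut_rel.
Qed.

Definition small (c : aut E) : Prop := exists M, near M c 1.

Lemma fresh_moved c L : exists v, ~~ meets v L /\ (small c \/ ~ E v (c v)).
Proof.
have [sc|nsc] := pselect (small c).
  by have [v vL] := fresh_point L; exists v; split=> //; left.
(* Otherwise [L] itself would witness that [c] is small. *)
apply: contrapT => noV; apply: nsc; exists (size L), L => // v vL.
by apply: contrapT => vc; apply: noV; exists v; split=> //; right=> /Esym.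
Qed.

(** * Reduction of words *)

Section Words.
Variable r : nat.
Implicit Types (s : seq ('I_r * bool * aut E)) (t : 'I_r * bool * aut E).

(* x_i^e c followed by x_i^-e with c small is near 1 for every substitution. *)
Definition noncancel t t' : bool :=
  ~~ ((t'.1 == (t.1.1, ~~ t.1.2)) && `[< small t.2 >]).

Lemma reduce_word s : exists c s' M, [/\ sorted noncancel s',
  forget s' = forget s & forall g, near M (word_val g s) (c * word_val g s')].
Proof.
elim: s => [|t s [c [s' [M [s'red s's sM]]]]].
  by exists 1, [::], 0; split=> // g; rewrite mul1g; apply: near_refl.
have [[t' [s2 [s'E t'E [M' tM']]]]|ncan] := pselect (exists t' s2,
    [/\ s' = t' :: s2, t'.1 = (t.1.1, ~~ t.1.2) & small (t.2 * c)]).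
  (* The constant [t.2 * c] between [t] and [t'] is small, so their letters cancel at a cost [M']
     independent of [g]; [t'.2] becomes the leading constant. *)
  exists t'.2, s2, (M + M'); split.
  - by move: s'red; rewrite s'E => /path_sorted.
  - rewrite /forget big_cons -/(forget s) -s's s'E /forget big_cons t'E.
    by rewrite letter_valV mulVKg.
  - move=> g; rewrite word_val_cons.
    apply: near_trans (near_mull _ (sM g)) _.
    have := near_mull (letter_val g t.1) (near_mulr (word_val g s') tM').
    by rewrite s'E word_val_cons t'E letter_valV mul1g !mulgA mulgV mul1g.
exists 1, ((t.1, t.2 * c) :: s'), M; split.
- case: s' s'red ncan {s's sM} => //= t' s2 -> ncan; rewrite andbT.
  apply/negP => /andP[/eqP t'E /asboolP sm]; apply: ncan.
  by exists t', s2.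
- by rewrite /forget !big_cons -/(forget _) s's.
- move=> g; rewrite mul1g !word_val_cons /= -!mulgA.
  by do 2! apply: near_mull.
Qed.

(** * Prescribing values of the variables on classes *)

(* The triple (i, (a, b)) requires x_i to map the class of a to that of b. *)
Implicit Types (T : seq ('I_r * (X * X))) (z : 'I_r * (X * X)).

Definition arrow (a : 'I_r * bool) (u v : X) : 'I_r * (X * X) :=
  (a.1, if a.2 then (v, u) else (u, v)).

(** Pairwise independence makes the requirements on each variable a partial injection of classes. *)
Definition indep z z' : bool :=
  (z'.1 == z.1) ==>
    (~~ `[< E z'.2.1 z.2.1 >] && ~~ `[< E z'.2.2 z.2.2 >]).

Definition sat (g : 'I_r -> aut E) T : bool :=
  all (fun z => `[< E (g z.1 z.2.1) z.2.2 >]) T.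

Lemma sat_exists T : pairwise indep T -> exists g, sat g T.
Proof.
elim: T => [_|z T IH]; first by exists (fun=> 1).
rewrite pairwise_cons => /andP[zT /IH[g gT]].
have [gz|ngz] := pselect (E (g z.1 z.2.1) z.2.2).
  by exists g; rewrite /sat /= -/(sat g T) gT andbT; apply/asboolP.
(* The class hit by [g z.1] is swapped with the wanted one. By independence, and since [g z.1] is
   injective on classes, no other requirement on this variable has either as its target. *)
have [h [hz hfix]] := class_swap ngz.
exists (fun i => if i == z.1 then g i * h else g i).
rewrite /sat /= eqxx; apply/andP; split; first exact/asboolP.
elim: T zT gT {IH} => //= z' T IH /andP[zz' zT] /andP[/asboolP gz' gT].
rewrite IH // andbT; apply/asboolP.
move: zz'; rewrite /indep; case: eqP => //= e /andP[/asboolPn n1 /asboolPn n2].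
rewrite hfix //.
- move: gz'; rewrite e => gz' gzz'; apply: n1; apply: Esym.
  by rewrite (aut_rel (g z.1)).
- by move=> zg; apply: n2; apply: Esym; apply: Etrans zg gz'.
Qed.

Lemma sat_arrow g a u v T : sat g (arrow a u v :: T) -> E (letter_val g a u) v.
Proof.
case: a => i [] /andP[/asboolP /= guv _]; rewrite /letter_val //=.
by apply: Esym; rewrite (aut_rel (g i)) autVK.
Qed.

(** An inverse letter reads requirements from their targets; if none there meets the class of [u],
    the image of [u] under [a] can still be chosen. *)
Definition free_at (a : 'I_r * bool) u T : bool :=
  all (fun z => (z.1 == a.1) ==>
    ~~ `[< E (if a.2 then z.2.2 else z.2.1) u >]) T.

Definition points T : seq X := flatten [seq [:: z.2.1; z.2.2] | z <- T].

Lemma fresh_free_at a v T : ~~ meets v (points T) -> free_at a v T.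
Proof.
elim: T => // z T IH /meetsPn[z1 /meetsPn[z2 /IH]].
rewrite /free_at /= => ->; rewrite andbT.
by apply/implyP => _; apply/asboolPn; case: a.2.
Qed.

Lemma arrow_indep a u v T :
  free_at a u T -> ~~ meets v (points T) -> all (indep (arrow a u v)) T.
Proof.
elim: T => // z T IH /andP[zu uT] /meetsPn[z1 /meetsPn[z2 vT]].
rewrite /= IH // andbT /indep /=; case: eqP zu => //= _.
by case: a.2 => -> /=; rewrite ?andbT; apply/asboolPn.
Qed.

(* Each letter goes to a fresh point v that its constant c moves out of its
   class unless c is small; then the only earlier class the next letter could
   collide with, that of v, is avoided because the word does not cancel. *)
Lemma walk s t T u A : pairwise indep T -> path noncancel t s ->
  free_at t.1 u T -> exists T' v, [/\ pairwise indep (T' ++ T), ~~ meets v A &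
    forall g, sat g (T' ++ T) -> E (word_val g (t :: s) u) v].
Proof.
elim: s t T u => [|t' s IH] t T u Tind ts uT.
  (* The trajectory ends at [t.2 v], so [A] is pulled back along [t.2]. *)
  have [v] := fresh_point (points T ++ map (t.2^-1)%g A).
  rewrite /meets has_cat negb_or -!/(meets _ _) meets_mapV => /andP[vT vA].
  exists [:: arrow t.1 u v], (t.2 v); split=> //=.
    by rewrite Tind arrow_indep.
  move=> g /sat_arrow guv.
  by rewrite word_val_cons /word_val big_nil mulg1 aut_mulE -aut_rel.
have [v []] := fresh_moved t.2 (points T ++ map (t.2^-1)%g (u :: points T)).
rewrite /meets has_cat negb_or -!/(meets _ _) meets_mapV.
move=> /andP[vT /meetsPn[uv' v'T]] vmoved.
have Tind' : pairwise indep (arrow t.1 u v :: T).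
  by rewrite pairwise_cons Tind arrow_indep.
move: ts => /= /andP[tt' ts].
have v'free : free_at t'.1 (t.2 v) (arrow t.1 u v :: T).
  rewrite /free_at /= -/(free_at t'.1 (t.2 v) T) fresh_free_at // andbT.
  apply/implyP => /eqP ii'; apply/asboolPn => bad.
  (* For equal signs the collision is with [u], excluded by [uv']; for opposite signs it is with
     [v], and then [t.2] is not small, so [vmoved] excludes it. *)
  move: tt' bad; rewrite /noncancel; case: t'.1 ii' => i' b' /= <-.
  case: t.1 => i b /=; rewrite xpair_eqE eqxx /=.
  by case: b; case: b' => //= /asboolPn nsm; case: vmoved.
have [T' [w [T'ind wA T'sat]]] := IH _ _ _ Tind' ts v'free.
exists (rcons T' (arrow t.1 u v)), w; rewrite cat_rcons; split=> // g gT'.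
have /sat_arrow guv : sat g (arrow t.1 u v :: T).
  by move: gT'; rewrite /sat all_cat => /andP[].
rewrite word_val_cons !aut_mulE; apply: Etrans (T'sat g gT').
by rewrite -!aut_rel.
Qed.

(** * Counting the classes where a reduced word deviates from [d] *)

Lemma many_moved s t d M : path noncancel t s -> exists T P,
  [/\ pairwise indep T, size P = M,
      pairwise (fun x y => ~~ `[< E y x >]) P &
      forall g, sat g T ->
        all (fun p => ~~ `[< E (word_val g (t :: s) p) (d p) >]) P].
Proof.
move=> ts; elim: M => [|M [T [P [Tind PM Pind PT]]]].
  by exists [::], [::].
have [p] := fresh_point (points T ++ P).
rewrite /meets has_cat negb_or -!/(meets _ _) => /andP[pT pP].
(* The new trajectory must end outside the class of [d p]; since [T] is only extended, the earlier
   points of [P] still deviate. *)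
have [T' [v [T'ind vd T'sat]]] :=
  walk [:: d p] Tind ts (fresh_free_at t.1 pT).
exists (T' ++ T), (p :: P); split=> //=; first by rewrite PM.
  by rewrite Pind andbT all_predC.
move=> g gT'; rewrite PT ?andbT; last first.
  by move: gT'; rewrite /sat all_cat => /andP[].
apply/asboolPn => bad; move: vd => /meetsPn[ndv _]; apply: ndv.
exact: Etrans (Esym bad) (T'sat g gT').
Qed.

Lemma independent_size (P L : seq X) :
  pairwise (fun x y => ~~ `[< E y x >]) P -> all (fun p => meets p L) P ->
  (size P <= size L)%N.
Proof.
(* The index of the first equivalent entry of [L] is injective on inequivalent points. *)
move=> Pind PL; pose idx p := find (fun y => `[< E y p >]) L.
rewrite -(size_map idx) -(size_iota 0 (size L)); apply: uniq_leq_size.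
  elim: P Pind PL => //= p P IH /andP[pP Pind] /andP[pL PL].
  rewrite IH // andbT; elim: P pP PL {IH Pind} => //= q P IH.
  move=> /andP[/asboolPn npq pP] /andP[qL PL]; rewrite inE negb_or IH // andbT.
  apply/eqP => pq; apply: npq.
  have /asboolP Eq := nth_find p qL; have /asboolP Ep := nth_find p pL.
  by apply: Etrans (Esym Eq) _; rewrite -/(idx q) -pq.
move=> n; rewrite mem_iota add0n /=; elim: P PL {Pind} => //= p P IH.
move=> /andP[pL PL]; rewrite inE => /orP[/eqP->|/IH]; last exact.
by rewrite -has_find.
Qed.

Lemma reduced_not_near t s d M : path noncancel t s ->
  exists g, ~ near M (word_val g (t :: s)) d.
Proof.
move=> ts; have [T [P [Tind PM Pind PT]]] := many_moved d M.+1 ts.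
have [g gT] := sat_exists Tind; exists g => -[L LM Lnear].
have : (size P <= size L)%N.
  apply: independent_size Pind _; apply: sub_all (PT g gT) => p.
  by apply: contraNT => /Lnear /asboolP.
by rewrite PM => /leq_trans/(_ LM); rewrite ltnn.
Qed.

End Words.

End Classes.

Theorem corollary3p2p1 (X : Type) (E : X -> X -> Prop) (k : nat)
    (X_countable : ([set: X] #= [set: nat])%card)
    (k_ge1 : (1 <= k)%N)
    (E_equiv : Equivalence E)
    (E_class : forall x : X, ([set y | E x y]%classic #= `I_k)%card) :
  ~ exists (r : nat) (w : cword (aut E) r), mixed_identity w /\ ~ singular w.
Proof.
move=> [r [w [[_ w1] nsing]]]; have [c [s wE]] := cword_ofP w.
have [d [s' [M [s'red s's sM]]]] := reduce_word E_equiv s.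
(* If every letter cancelled, the augmentation of [w] would be trivial. *)
case: s' s'red s's sM => [_ s's _|t s' s'red _ sM].
  apply: nsing; rewrite /singular wE augmentation_cword_of -s's.
  by rewrite /forget big_nil.
(* Since [word_val g s] is always [c^-1], every value of the reduced word is within [M] classes of
   [d^-1 * c^-1]. *)
have [g ng] :=
  reduced_not_near E_equiv X_countable E_class (d^-1 * c^-1) M s'red.
have sE : word_val g s = c^-1.
  by apply: (mulgI c); rewrite mulgV -weval_cword_of -wE w1.
apply: ng; have := near_mull d^-1 (near_sym E_equiv (sM g)).
by rewrite sE mulKg.
Qed.
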